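(* Let $n\ge 2$ be a natural number and let $Q:=[0,\infty)^n\subseteq\mathbb{R}^n$. For each $\sigma\in \mathrm{Sym}(n)$, let $s^{(\sigma)}$ be a real number or $\pm\infty$. Then there exists a function $f\in C^\infty(Q)$ such that $$\int_0^\infty\dots \int_0^\infty f(x_1,\dots,x_n)\,dx_{\sigma(1)}\,dx_{\sigma(2)}\dots\,dx_{\sigma(n)}=s^{(\sigma)} \quad\text{for each } \sigma\in \mathrm{Sym}(n).$$
   Context: $\mathrm{Sym}(n)$ is the group of all permutations of $\{1,\dots,n\}$. $C^\infty(Q)$ denotes the real-valued functions on $Q$ that are infinitely differentiable (smooth up to the boundary of $Q$). The integral is an iterated integral: one integrates first with respect to $x_{\sigma(1)}$ (innermost), then $x_{\sigma(2)}$, and so on, and last with respect to $x_{\sigma(n)}$ (outermost). Each one-dimensional integral $\int_0^\infty$ is an improper Riemann integral, i.e. $\lim_{R\to\infty}\int_0^R$. The equality includes the assertion that the inner integrals exist as real numbers; the outermost one converges to $s^{(\sigma)}$ if $s^{(\sigma)}$ is real and diverges to $\pm\infty$ if $s^{(\sigma)}=\pm\infty$. *)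

(* Defs.v *)
(* The real numbers, Riemann integrals and limits are those of Stdlib and
   Coquelicot; finite index types and permutations are those of MathComp. *)
From Stdlib Require Import Reals.
From Coquelicot Require Import Coquelicot.
From mathcomp Require Import all_boot all_fingroup.
Set Implicit Arguments.
Unset Strict Implicit.
Unset Printing Implicit Defensive.
Local Open Scope R_scope.

(* R^n is 'I_n -> R, with coordinates numbered from 0. Coquelicot's uniform
   structure on it is the sup metric, so [locally x] is the Euclidean
   neighbourhood filter. *)
Definition orthant (n : nat) (x : 'I_n -> R) : Prop := forall i, 0 <= x i.

(* In this definition and all those below, the values of f outside the orthant
   play no role. *)
Definition continuous_on_orthant (n : nat) (f : ('I_n -> R) -> R) : Prop :=
  forall x, orthant x ->
    filterlim f (within (@orthant n) (locally x)) (locally (f x)).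

(* g is the i-th partial derivative of f at every point of the orthant, one-sided
   at the points where x i = 0: this is Coquelicot's [is_derive] in the variable
   x i with [locally (x i)] replaced by its trace on [0, +oo[. *)
Definition is_partial_on_orthant (n : nat) (f : ('I_n -> R) -> R) (i : 'I_n)
    (g : ('I_n -> R) -> R) : Prop :=
  forall x, orthant x ->
    filterdiff (fun t : R => f [eta x with i |-> t])
      (within (fun t : R => 0 <= t) (locally (x i)))
      (fun t : R => scal t (g x)).

(* All partial derivatives of order at most k exist and are continuous on the
   orthant, boundary included. *)
Fixpoint Ck_on_orthant (n k : nat) (f : ('I_n -> R) -> R) : Prop :=
  continuous_on_orthant f /\
  match k with
  | 0%N => True
  | k'.+1 => forall i : 'I_n, exists g : ('I_n -> R) -> R,
               is_partial_on_orthant f i g /\ Ck_on_orthant k' g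
  end.

Definition smooth_on_orthant (n : nat) (f : ('I_n -> R) -> R) : Prop :=
  forall k : nat, Ck_on_orthant k f.

(* Coquelicot's [is_RInt_gen] only covers real values; here v may be infinite. *)
Definition is_improper_RInt (h : R -> R) (v : Rbar) : Prop :=
  (forall b : R, 0 <= b -> ex_RInt h 0 b) /\
  is_lim (fun b : R => RInt h 0 b) p_infty v.

(* v is the iterated integral over [0, +oo[ of f in the variables of l, the
   outermost variable being the head of l, and the variables not in l being
   fixed to their values in x. All integrals but the outermost one are required
   to be real, for all nonnegative values of the remaining variables. *)
Fixpoint is_iterated_RInt_seq (n : nat) (f : ('I_n -> R) -> R) (l : seq 'I_n)
    (x : 'I_n -> R) (v : Rbar) : Prop :=
  match l with
  | [::] => v = Rbar.Finite (f x)
  | i :: l' => exists h : R -> R,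
      (forall t : R, 0 <= t ->
         is_iterated_RInt_seq f l' [eta x with i |-> t] (Rbar.Finite (h t))) /\
      is_improper_RInt h v
  end.

(* Integration first in the variable sigma 0 and last in sigma (n - 1); since
   every coordinate is integrated, the starting point does not matter. *)
Definition is_iterated_RInt (n : nat) (f : ('I_n -> R) -> R) (sigma : 'S_n)
    (v : Rbar) : Prop :=
  is_iterated_RInt_seq f (rev [seq sigma i | i <- enum 'I_n]) (fun _ => 0) v.

(* Main.v *)
(* The orthant is cut into unit cubes indexed by arrays k of natural numbers, and
   f equals a(k) times a translated product bump on the cube k. The bump has
   integral 1 and vanishes to infinite order at the faces, so f is smooth and its
   iterated integrals are the iterated sums of the array a.

   By linearity it suffices to find, for each order l = i :: m of summation (i
   outermost), an array whose iterated sum is the prescribed value in the order l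
   and 0 in all other orders. By induction there are arrays E_c, supported where
   all coordinates in m are at least c, with iterated sum 1 in the order m and 0
   in the other orders of m. Take
     a(k) = w(k_i) E_(k_i)(k) - w(k_i - 1) E_(k_i - 1)(k)
   with w tending to the prescribed value. After summation over some of the
   coordinates in m, the sum over k_i telescopes to the limit of w(N) times the
   partial iterated sum of E_N. If a coordinate of m is left, this is 0 for large
   N because the support of E_N escapes to infinity; otherwise the partial sum is
   1 in the order m and 0 in the others. Choosing w to be the indicator function
   of [c, +oo[ continues the induction. *)
Require Import Defs.
From Stdlib Require Import ZArith Reals Lra FunctionalExtensionality.
From Coquelicot Require Import Coquelicot.
From HB Require Import structures.
From mathcomp Require Import all_boot all_fingroup zify.
Set Implicit Arguments.
Unset Strict Implicit.
Unset Printing Implicit Defensive.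
Local Open Scope R_scope.

HB.instance Definition _ := Monoid.isComLaw.Build R 0 Rplus
  (fun x y z => esym (Rplus_assoc x y z)) Rplus_comm Rplus_0_l.
HB.instance Definition _ := Monoid.isComLaw.Build R 1 Rmult
  (fun x y z => esym (Rmult_assoc x y z)) Rmult_comm Rmult_1_l.

(** * Iterated sums of arrays *)

Section Arrays.
Variable I : eqType.
Implicit Types (a g : (I -> nat) -> R) (E V : nat -> (I -> nat) -> R).
Implicit Types (k : I -> nat) (l p q r : seq I) (w : nat -> R).

Fixpoint is_iterated_sum a l k (v : Rbar) : Prop :=
  match l with
  | [::] => v = Rbar.Finite (a k)
  | i :: l' => exists h : nat -> R,
      (forall m,
         is_iterated_sum a l' [eta k with i |-> m] (Rbar.Finite (h m))) /\
      is_lim_seq (sum_n h) v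
  end.

(** Summing over [q] only visits arrays that agree with [k] off [q]. This locality later allows the
    coordinate [i] of [telescope] to be treated as a constant. *)
Lemma is_iterated_sum_ext a g q k v :
  (forall k', (forall i, i \notin q -> k' i = k i) -> a k' = g k') ->
  is_iterated_sum a q k v -> is_iterated_sum g q k v.
Proof.
elim: q k v => [|i q IHq] k v eq_ag /=; first by move=> ->; rewrite eq_ag.
move=> [h [sum_h lim_h]]; exists h; split=> // m; apply: IHq (sum_h m).
move=> k' eq_k'; apply: eq_ag => j.
rewrite inE negb_or => /andP[/negPf ne_ji jq].
by rewrite eq_k' //= ne_ji.
Qed.

(** Since [v] may be infinite, the second sum is 0, so that no undefined sum of infinities arises;
    the inner sums are real and simply add. *)
Lemma is_iterated_sum_plus a g q k v :
  is_iterated_sum a q k v -> is_iterated_sum g q k (Rbar.Finite 0) ->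
  is_iterated_sum (fun k => a k + g k) q k v.
Proof.
case: q => [|i q] /=; first by move=> -> [<-]; rewrite Rplus_0_r.
have real_plus : forall q k (x y : R), is_iterated_sum a q k x ->
    is_iterated_sum g q k y -> is_iterated_sum (fun k => a k + g k) q k (x + y).
  elim=> [|j q' IHq] k' x y /=; first by move=> [->] [->].
  move=> [h [sum_h lim_h]] [h' [sum_h' lim_h']].
  exists (fun m => h m + h' m); split; first by move=> m; apply: IHq.
  apply: is_lim_seq_ext (is_lim_seq_plus' _ _ _ _ lim_h lim_h') => N.
  by rewrite sum_n_plus.
move=> [h [sum_h lim_h]] [h' [sum_h' lim_h']].
exists (fun m => h m + h' m); split; first by move=> m; apply: real_plus.
apply: is_lim_seq_ext (is_lim_seq_plus _ _ _ _ v lim_h lim_h' _) => [N|].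
  by rewrite sum_n_plus.
by case: v {lim_h} => [x| |] //=; rewrite /is_Rbar_plus /= ?Rplus_0_r.
Qed.

Lemma is_iterated_sum_zero q k : is_iterated_sum (fun=> 0) q k (Rbar.Finite 0).
Proof.
elim: q k => [|i q IHq] k //=; exists (fun=> 0); split=> //.
apply: is_lim_seq_ext (is_lim_seq_const 0) => N.
by rewrite sum_n_const Rmult_0_r.
Qed.

Lemma is_iterated_sum_big0 (J : Type) (s : seq J) (P : pred J)
    (A : J -> (I -> nat) -> R) q k :
  (forall j, P j -> is_iterated_sum (A j) q k (Rbar.Finite 0)) ->
  is_iterated_sum (fun k => \big[Rplus/0]_(j <- s | P j) A j k) q k
    (Rbar.Finite 0).
Proof.
move=> sumA; elim: s => [|j s IHs].
  apply: is_iterated_sum_ext (is_iterated_sum_zero q k) => k' _.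
  by rewrite big_nil.
have [Pj|nPj] := boolP (P j).
  apply: is_iterated_sum_ext (is_iterated_sum_plus (sumA j Pj) IHs) => k' _.
  by rewrite big_cons Pj.
by apply: is_iterated_sum_ext IHs => k' _; rewrite big_cons (negPf nPj).
Qed.

Lemma is_iterated_sum_lin a g q k (c d x y : R) :
  is_iterated_sum a q k x -> is_iterated_sum g q k y ->
  is_iterated_sum (fun k => c * a k - d * g k) q k (c * x - d * y).
Proof.
elim: q k x y => [|j q IHq] k x y /=; first by move=> [->] [->].
move=> [h [sum_h lim_h]] [h' [sum_h' lim_h']].
exists (fun m => c * h m - d * h' m); split; first by move=> m; apply: IHq.
have := is_lim_seq_minus' _ _ _ _ (is_lim_seq_scal_l _ c _ lim_h)
  (is_lim_seq_scal_l _ d _ lim_h').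
apply: is_lim_seq_ext => N.
elim: N => [|N IHN]; first by rewrite !sum_O.
rewrite !sum_Sn /plus /= -IHN; ring.
Qed.

Lemma is_iterated_sum_cat0 a p q k :
  (forall k', is_iterated_sum a q k' (Rbar.Finite 0)) ->
  is_iterated_sum a (p ++ q) k (Rbar.Finite 0).
Proof.
move=> sum0; elim: p k => [|i p IHp] k //=.
exists (fun=> 0); split=> [m|]; first exact: IHp.
apply: is_lim_seq_ext (is_lim_seq_const 0) => N.
by rewrite sum_n_const Rmult_0_r.
Qed.

(** * Telescoping arrays that detect the order of summation *)

(* As k i runs through 0 .. N, these values add up to w N * E N k, provided
   that E does not depend on the coordinate i. *)
Definition telescope w (i : I) E k : R :=
  w (k i) * E (k i) k - (if k i is m.+1 then w m * E m k else 0).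

Lemma sum_telescope w (u : nat -> R) N :
  sum_n (fun m => w m * u m - (if m is m'.+1 then w m' * u m' else 0)) N =
  w N * u N.
Proof.
elim: N => [|N IHN]; first by rewrite sum_O /=; ring.
by rewrite sum_Sn IHN /plus /=; ring.
Qed.

(** While [q] is summed, [k i] is frozen, so the telescoping array is a linear combination of at
    most two of the arrays [E c]. *)
Lemma is_iterated_sum_telescope w i E q V k : i \notin q ->
  (forall c k, is_iterated_sum (E c) q k (V c k)) ->
  is_iterated_sum (telescope w i E) q k (telescope w i V k).
Proof.
move=> iq sumE; rewrite /telescope.
case ki: (k i) => [|m].
  have := is_iterated_sum_lin (w 0%N) 0 (sumE 0%N k) (sumE 0%N k).
  rewrite Rmult_0_l; apply: is_iterated_sum_ext => k' eqk.
  by rewrite eqk // ki Rmult_0_l.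
have := is_iterated_sum_lin (w m.+1) (w m) (sumE m.+1 k) (sumE m k).
by apply: is_iterated_sum_ext => k' eqk; rewrite eqk // ki.
Qed.

(* [E c] is, for each [c], an array supported in [{k | c <= k j for j in l}]
   whose iterated sum over [q] is 1 when [q = l] and 0 when [q] is any other
   ordering of [l]; [V c] is the array of the sums over a part [q] of [l]. *)
Definition order_detecting l E : Prop :=
  forall q, uniq q -> {subset q <= l} ->
  exists V, [/\
    forall c k, is_iterated_sum (E c) q k (V c k),
    forall c k k', {in l, k =1 k'} -> V c k = V c k',
    forall c k j, j \in l -> j \notin q -> (k j < c)%N -> V c k = 0 &
    perm_eq q l -> forall c k, V c k = if q == l then 1 else 0].

(** The sums over [r] leave [telescope w i V]. As [i] is outside [m], [V] ignores the coordinate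
    [i], and the outermost partial sums collapse to [w N * V N k]. *)
Lemma lim_telescope w i (m r : seq I) E k V v :
  i \notin m -> i \notin r ->
  (forall c k, is_iterated_sum (E c) r k (V c k)) ->
  (forall c k k', {in m, k =1 k'} -> V c k = V c k') ->
  is_lim_seq (fun N => w N * V N k) v ->
  is_iterated_sum (telescope w i E) (i :: r) k v.
Proof.
move=> im ir sumV extV limV /=.
exists (fun t => telescope w i V [eta k with i |-> t]); split.
  by move=> t; apply: is_iterated_sum_telescope.
apply: is_lim_seq_ext limV => N.
rewrite -(sum_telescope w (fun t => V t k)).
apply: sum_n_ext => t; rewrite /telescope /= eqxx.
have eqV c : V c [eta k with i |-> t] = V c k.
  by apply: extV => j jm /=; case: eqP jm im => // -> ->.
by case: t eqV => [|t] eqV; rewrite !eqV.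
Qed.

Lemma is_iterated_sum_telescope_id w i m E k v :
  uniq (i :: m) -> order_detecting m E -> is_lim_seq w v ->
  is_iterated_sum (telescope w i E) (i :: m) k v.
Proof.
move=> /= /andP[im um] /(_ m um (fun _ H => H))[V [sumV extV _ valV]] limw.
apply: (lim_telescope im im sumV extV).
by apply: is_lim_seq_ext limw => N; rewrite valV // eqxx Rmult_1_r.
Qed.

(** Write [q] as [p ++ i :: r]. It is enough that the sum over [i :: r] always vanishes, since the
    outer sums over [p] then add zeros. *)
Lemma is_iterated_sum_telescope_neq w i m E q k :
  uniq (i :: m) -> order_detecting m E -> uniq q ->
  {subset q <= i :: m} -> i \in q -> q != i :: m ->
  is_iterated_sum (telescope w i E) q k (Rbar.Finite 0).
Proof.
move=> /= /andP[im um] detE uq qm iq; case/splitPr: iq uq qm => p r.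
rewrite cat_uniq /= => /and4P[up /norP[ip pr] ir ur] qm neq.
have rm : {subset r <= m}.
  move=> j jr; have := qm j; rewrite mem_cat inE jr !orbT inE => /(_ isT).
  by case: eqP jr ir => // -> ->.
have [V [sumV extV vanV valV]] := detE r ur rm.
apply: is_iterated_sum_cat0 => k'.
apply: (lim_telescope im ir sumV extV).
(* If [r] exhausts [m], then [p] is empty and [r] is an order of [m] other than [m] itself, so [V]
   is 0. *)
have [perm_rm|nperm_rm] := boolP (perm_eq r m).
  have p0 : p = [::].
    case: p up ip pr qm neq => // j p /= /andP[jp _].
    rewrite inE negb_or => /andP[ij _] /hasPn nr /(_ j (mem_head _ _)).
    rewrite inE eq_sym (negPf ij) /= -(perm_mem perm_rm) => /nr.
    by rewrite inE eqxx.
  move: neq; rewrite p0 /= eqseq_cons eqxx /= => /negPf neq.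
  apply: is_lim_seq_ext (is_lim_seq_const 0) => N.
  by rewrite valV // neq Rmult_0_r.
(* Otherwise some [j] of [m] is still fixed, and [V N] vanishes at [k'] once [N] exceeds [k' j]. *)
have [j jm jr] : exists2 j, j \in m & j \notin r.
  apply/allPn; apply: contra nperm_rm => /allP mr.
  by apply: uniq_perm => // j; apply/idP/idP => [/rm|/mr].
apply: is_lim_seq_ext_loc (is_lim_seq_const 0).
exists (k' j).+1 => N /leP ltN; rewrite (vanV N k' j) // Rmult_0_r //.
Qed.

Definition step (c m : nat) : R := if (c <= m)%N then 1 else 0.

Fixpoint unit_array l c : (I -> nat) -> R :=
  match l with
  | [::] => fun=> 1
  | i :: l' => telescope (step c) i (unit_array l')
  end.

Lemma order_detecting_unit_array l : uniq l -> order_detecting l (unit_array l).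
Proof.
elim: l => [_|i m IHm ulm].
  case=> [_ _|j q _ /(_ j (mem_head _ _))] //.
  by exists (fun _ _ => 1); split.
have /= /andP[im um] := ulm; have {IHm}detm := IHm um => q uq qm.
(* If [i] is summed, the telescoping lemmas give a constant, 1 or 0; if not, the partial sums for
   [m] carry over through [telescope]. *)
have [iq|iq] := boolP (i \in q).
  exists (fun _ _ => if q == i :: m then 1 else 0); split=> //.
    move=> c k; case: eqP => [->|/eqP neq]; last first.
      exact: is_iterated_sum_telescope_neq ulm detm uq qm iq neq.
    apply: is_iterated_sum_telescope_id ulm detm _.
    apply: is_lim_seq_ext_loc (is_lim_seq_const 1).
    by exists c => N /leP leN; rewrite /step leN.
  by move=> c k j jm jq _; case: eqP => // qE; rewrite qE jm in jq.
have {}qm : {subset q <= m}.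
  by move=> j jq; have := qm j jq; rewrite inE; case: eqP jq iq => // -> ->.
have [V [sumV extV vanV _]] := detm q uq qm.
exists (fun c => telescope (step c) i V); split.
- by move=> c k; apply: is_iterated_sum_telescope.
- move=> c k k' eqk; rewrite /telescope eqk ?mem_head //.
  have eqV d : V d k = V d k'.
    by apply: extV => j jm; rewrite eqk // inE jm orbT.
  by case: (k' i) => [|t]; rewrite !eqV.
- move=> c k j; rewrite inE /telescope => jl jq kjc.
  (* Both indices in the telescope are at most [k i]. If [t < c], the step is 0; if [c <= t <= k i],
     then [j] lies in [m] with [k j < t], so [V t] vanishes. *)
  have van t : (t <= k i)%N -> step c t * V t k = 0.
    rewrite /step; case: (leqP c t) => ct tk; last by rewrite Rmult_0_l.
    case/orP: jl => [/eqP ji|jm]; first by rewrite -ji in tk; lia.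
    by rewrite (vanV t k j) ?Rmult_0_r //; lia.
  rewrite van //; case ki: (k i) => [|t]; first by ring.
  by rewrite van ?ki //; ring.
- by move=> /perm_mem /(_ i); rewrite mem_head (negPf iq).
Qed.

(** A general weight [w] replaces the outermost [step], so that its limit is detected instead of
    1. *)
Definition order_array w l : (I -> nat) -> R :=
  if l is i :: m then telescope w i (unit_array m) else fun=> 0.

Lemma is_iterated_sum_order_array w l q k v :
  l != [::] -> uniq l -> uniq q -> q =i l -> is_lim_seq w v ->
  is_iterated_sum (order_array w l) q k (if q == l then v else Rbar.Finite 0).
Proof.
case: l => // i m _ ulm uq ql limw; have /= /andP[_ um] := ulm.
have detm := order_detecting_unit_array um.
case: eqP => [->|/eqP neq].
  exact: is_iterated_sum_telescope_id ulm detm limw.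
apply: (is_iterated_sum_telescope_neq w _ ulm detm uq _ _ neq) => [j|].
  by rewrite ql.
by rewrite ql mem_head.
Qed.

End Arrays.

(** * Arrays with prescribed iterated sums *)

Lemma exists_lim_seq (v : Rbar) : exists w : nat -> R, is_lim_seq w v.
Proof.
case: v => [x| |]; [exists (fun=> x)|exists INR|exists (fun n => - INR n)].
- exact: is_lim_seq_const.
- exact: is_lim_seq_INR.
- exact: (proj1 (is_lim_seq_opp INR p_infty) is_lim_seq_INR).
Qed.

Lemma exists_array (n : nat) (s : 'S_n -> Rbar) (order : 'S_n -> seq 'I_n) :
  injective order -> (forall sigma, uniq (order sigma)) ->
  (forall sigma i, i \in order sigma) -> (0 < n)%N ->
  exists a : ('I_n -> nat) -> R,
    forall sigma k, is_iterated_sum a (order sigma) k (s sigma).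
Proof.
move=> inj_o uniq_o mem_o n_gt0.
have /fin_all_exists[w limw] sigma := exists_lim_seq (s sigma).
pose A sigma := order_array (w sigma) (order sigma).
exists (fun k => \big[Rplus/0]_sigma A sigma k) => tau k.
have A_notnil sigma : order sigma != [::].
  by have := mem_o sigma (Ordinal n_gt0); case: (order sigma).
have sumA sigma : is_iterated_sum (A sigma) (order tau) k
    (if order tau == order sigma then s sigma else Rbar.Finite 0).
  apply: is_iterated_sum_order_array => // i.
  by rewrite !mem_o.
apply: (@is_iterated_sum_ext _ (fun k => A tau k +
    \big[Rplus/0]_(sigma | sigma != tau) A sigma k)).
  by move=> k' _; rewrite [RHS](bigD1 tau).
apply: is_iterated_sum_plus; first by have := sumA tau; rewrite eqxx.
apply: is_iterated_sum_big0 => sigma ne; have := sumA sigma.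
by rewrite (inj_eq inj_o) eq_sym (negPf ne).
Qed.

(** * Flat functions and bumps on the unit interval *)

Definition flat (b : nat) (u : R) : R :=
  match Rlt_dec 0 u with
  | left _ => (/ u) ^ b * exp (- / u)
  | right _ => 0
  end.

(** The inequality [1 + x <= exp x] at [x = w / m], raised to the power [m]; for [m = 0] the
    constant [INR 0 ^ 0] is 1. *)
Lemma pow_le_exp (m : nat) (w : R) : 0 <= w -> w ^ m <= INR m ^ m * exp w.
Proof.
case: m => [|m] w0.
  by have := exp_ineq1_le w; rewrite /=; lra.
have m0 : 0 < INR m.+1 by apply: lt_0_INR; lia.
have le1 : w / INR m.+1 <= exp (w / INR m.+1).
  by have := exp_ineq1_le (w / INR m.+1); lra.
have -> : exp w = exp (w / INR m.+1) ^ m.+1.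
  rewrite -Rpower_pow; last exact: exp_pos.
  by rewrite /Rpower ln_exp; congr exp; field; lra.
rewrite -Rpow_mult_distr; apply: pow_incr; split=> //.
apply: Rle_trans (Rmult_le_compat_l (INR m.+1) _ _ _ le1); last lra.
by right; field; lra.
Qed.

(** This quadratic bound forces the derivative at 0 to be 0. It is [pow_le_exp] at [/ u] with
    exponent [b + 2]. *)
Lemma flat_le (b : nat) (u : R) : 0 <= flat b u <= INR b.+2 ^ b.+2 * u ^ 2.
Proof.
rewrite /flat; case: Rlt_dec => [u0|_]; last first.
  split; [lra|apply: Rmult_le_pos; last exact: pow2_ge_0].
  by apply: pow_le; apply: pos_INR.
have iu0 := Rinv_0_lt_compat _ u0.
split; first by apply: Rmult_le_pos; [apply: pow_le; lra|left; apply: exp_pos].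
have := pow_le_exp b.+2 (Rlt_le _ _ iu0) => le2.
rewrite exp_Ropp; apply: (Rmult_le_reg_r (exp (/ u))); first exact: exp_pos.
apply: (Rmult_le_reg_r ((/ u) ^ 2)); first exact: pow_lt.
have e0 := exp_pos (/ u).
have -> : (/ u) ^ b * / exp (/ u) * exp (/ u) * (/ u) ^ 2 = (/ u) ^ b.+2.
  by simpl; field; lra.
apply: Rle_trans le2 _; right; simpl; field; lra.
Qed.

Lemma is_derive_eq (g : R -> R) (t l l' : R) :
  is_derive g t l -> l = l' -> is_derive g t l'.
Proof. by move=> dg <-. Qed.

Lemma is_derive_flat (b : nat) (u : R) :
  is_derive (flat b) u (flat b.+2 u - INR b * flat b.+1 u).
Proof.
case: (total_order_T u 0) => [[u0|->]|u0].
- have -> : flat b.+2 u - INR b * flat b.+1 u = 0.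
    by rewrite /flat; case: Rlt_dec => [?|_]; [lra|ring].
  apply: (is_derive_ext_loc (fun=> 0)); last exact: is_derive_const.
  exists (mkposreal (- u) ltac:(lra)) => y.
  rewrite /ball /= /AbsRing_ball /abs /minus /plus /opp /= => /Rabs_def2 ?.
  by rewrite /flat; case: Rlt_dec => // ?; lra.
- have -> : flat b.+2 0 - INR b * flat b.+1 0 = 0.
    by rewrite /flat; case: Rlt_dec => [?|_]; [lra|ring].
  apply/is_derive_Reals => eps eps0.
  pose C := INR b.+2 ^ b.+2.
  have C0 : 0 < C by apply: pow_lt; apply: lt_0_INR; lia.
  (* By [flat_le] the difference quotient at 0 is at most [C * Rabs h], whence this radius. *)
  have d0 : 0 < eps / C by apply: Rdiv_lt_0_compat.
  exists (mkposreal _ d0) => h h0 /= ltC.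
  have -> : flat b 0 = 0 by rewrite /flat; case: Rlt_dec => // ?; lra.
  rewrite Rplus_0_l !Rminus_0_r Rabs_div //.
  have [f0 fC] := flat_le b h; rewrite (Rabs_pos_eq _ f0).
  have ah := Rabs_pos_lt _ h0.
  apply: (Rle_lt_trans _ (C * Rabs h)).
    apply: (Rmult_le_reg_r (Rabs h)) => //.
    rewrite /Rdiv Rmult_assoc Rinv_l ?Rmult_1_r; last lra.
    apply: Rle_trans fC _; right; rewrite -/C -pow2_abs; ring.
  apply: (Rlt_le_trans _ (C * (eps / C))); first exact: Rmult_lt_compat_l.
  by right; field; lra.
- apply: (is_derive_ext_loc (fun u => (/ u) ^ b * exp (- / u))).
    exists (mkposreal u u0) => y.
    rewrite /ball /= /AbsRing_ball /abs /minus /plus /opp /= => /Rabs_def2 ?.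
    by rewrite /flat; case: Rlt_dec => // ?; lra.
  rewrite /flat; case: Rlt_dec => // _.
  auto_derive; first by repeat split; lra.
  case: b => [|b]; first by simpl; field; lra.
  rewrite -pred_Sn S_INR; simpl; field; lra.
Qed.

(* A class closed under differentiation, which dispenses with a formula for the
   higher derivatives of a bump. *)
Inductive bump_like : (R -> R) -> Prop :=
  | bump_like_flat b : bump_like (fun t => flat b (t * (1 - t)))
  | bump_like_plus g h :
      bump_like g -> bump_like h -> bump_like (fun t => g t + h t)
  | bump_like_affine c d g :
      bump_like g -> bump_like (fun t => (c + d * t) * g t).

Lemma bump_like_0 g : bump_like g -> forall t, t <= 0 \/ 1 <= t -> g t = 0.
Proof.
elim=> [b|g1 g2 _ IH1 _ IH2|c d g1 _ IH] t t01.
- by rewrite /flat; case: Rlt_dec => // ?; nra.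
- by rewrite IH1 // IH2 // Rplus_0_r.
- by rewrite IH // Rmult_0_r.
Qed.

Lemma bump_like_derive g : bump_like g ->
  exists2 h, bump_like h & forall t, is_derive g t (h t).
Proof.
elim=> [b|g1 g2 _ [h1 B1 D1] _ [h2 B2 D2]|c d g1 B1 [h1 B D]].
(* The chain rule, with the constant [- INR b] written as an affine factor to stay in the class. *)
- exists (fun t => (1 + (-2) * t) * (flat b.+2 (t * (1 - t)) +
             (- INR b + 0 * t) * flat b.+1 (t * (1 - t)))).
    by do !constructor.
  move=> t; have d1 : is_derive (fun t => t * (1 - t)) t (1 - 2 * t).
    by auto_derive => //; ring.
  have d2 := is_derive_flat b (t * (1 - t)).
  apply: is_derive_eq (is_derive_comp _ _ _ _ _ d2 d1) _.
  by rewrite /scal /= /mult /=; ring.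
- exists (fun t => h1 t + h2 t) => [|t]; first by constructor.
  exact: is_derive_plus.
- exists (fun t => (d + 0 * t) * g1 t + (c + d * t) * h1 t) => [|t].
    by do !constructor.
  have d1 : is_derive (fun t => c + d * t) t d by auto_derive => //; ring.
  apply: is_derive_eq (is_derive_mult _ _ t _ _ d1 (D t) Rmult_comm) _.
  by rewrite /mult /plus /=; ring.
Qed.

Lemma bump_like_continuous g t : bump_like g -> continuous g t.
Proof.
by move=> /bump_like_derive[h _ D]; apply: ex_derive_continuous; exists (h t).
Qed.

Lemma exists_bump : exists phi : R -> R,
  [/\ bump_like phi, forall t, 0 <= phi t & is_RInt phi 0 1 1].
Proof.
pose g t := flat 0 (t * (1 - t)).
have Bg : bump_like g by apply: bump_like_flat.
have g_ge0 t : 0 <= g t by case: (flat_le 0 (t * (1 - t))).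
have c0 : 0 < RInt g 0 1.
  apply: RInt_gt_0 => [|t t01|t _]; [lra| |exact: bump_like_continuous].
  rewrite /g /flat; case: Rlt_dec => [?|]; last by nra.
  by rewrite Rmult_1_l; apply: exp_pos.
exists (fun t => (/ RInt g 0 1 + 0 * t) * g t); split.
- by constructor.
- move=> t; apply: Rmult_le_pos => //; rewrite Rmult_0_l Rplus_0_r.
  by left; apply: Rinv_0_lt_compat.
- have exg : ex_RInt g 0 1.
    by apply: ex_RInt_continuous => t _; apply: bump_like_continuous.
  have := is_RInt_scal _ _ _ (/ RInt g 0 1) _ (RInt_correct _ _ _ exg).
  rewrite /scal /= /mult /= Rinv_l; last lra.
  by apply: is_RInt_ext => t _ /=; ring.
Qed.

(** * Integer parts and functions glued from cells of the half-line *)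

(** Negative reals are sent to 0. The bump of cell 0 vanishes there, so glued functions extend by 0
    and have two-sided derivatives at the boundary. *)
Definition nat_floor (t : R) : nat := Z.to_nat (Int_part t).

Lemma lt_nat_floor_plus1 (t : R) : t < INR (nat_floor t) + 1.
Proof.
have [le_t lt_t] := base_Int_part t.
have : IZR (Int_part t) <= INR (nat_floor t).
  by rewrite /nat_floor INR_IZR_INZ; apply: IZR_le; lia.
lra.
Qed.

Lemma nat_floor_le (t : R) : 0 <= t -> INR (nat_floor t) <= t.
Proof.
have [le_t lt_t] := base_Int_part t => t0.
have ip0 : (0 <= Int_part t)%Z.
  by have : (-1 < Int_part t)%Z; [apply: lt_IZR; lra|lia].
by rewrite /nat_floor INR_IZR_INZ Z2Nat.id.
Qed.

Lemma nat_floor_eq (m : nat) (t : R) :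
  INR m <= t < INR m + 1 -> nat_floor t = m.
Proof.
move=> [le_mt lt_tm]; have m0 := pos_INR m.
have := lt_nat_floor_plus1 t; have := @nat_floor_le t ltac:(lra).
move: (nat_floor t) => p le_pt lt_tp.
have lt1 : (p < m.+1)%coq_nat by apply: INR_lt; rewrite S_INR; lra.
have lt2 : (m < p.+1)%coq_nat by apply: INR_lt; rewrite S_INR; lra.
lia.
Qed.

Lemma nat_floor_neg (t : R) : t < 0 -> nat_floor t = 0%N.
Proof.
move=> t0; have [? _] := base_Int_part t; rewrite /nat_floor.
have : (Int_part t < 0)%Z by apply: lt_IZR; lra.
lia.
Qed.

Lemma nat_floor_leq (m : nat) (t : R) :
  t < INR m.+1 -> (nat_floor t <= m)%N.
Proof.
move=> lt_tm; case: (Rle_dec 0 t) => [/nat_floor_le le_t|nt].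
  have : (nat_floor t < m.+1)%coq_nat by apply: INR_lt; lra.
  lia.
by rewrite nat_floor_neg //; lra.
Qed.

(** Here [t] is outside the open interval from [m] to [m + 1]. Hence the term of the cell of [t] may
    be replaced by a finite sum over cells, which avoids the jumps of [nat_floor]. *)
Lemma bump_like_other_cell g (t : R) (m : nat) :
  bump_like g -> m <> nat_floor t -> g (t - INR m) = 0.
Proof.
move=> Bg ne; apply: bump_like_0 => //.
have lt_t := lt_nat_floor_plus1 t; have m0 := pos_INR m.
case: (leqP m (nat_floor t)) => [le|lt].
  right; have le2 : INR m + 1 <= INR (nat_floor t).
    by rewrite -S_INR; apply: le_INR; lia.
  have t0 : 0 <= t.
    by case: (Rlt_dec t 0) => [/nat_floor_neg ?|?]; [lia|lra].
  have := nat_floor_le t0; lra.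
left; have le2 : INR (nat_floor t) + 1 <= INR m.
  by rewrite -S_INR; apply: le_INR; lia.
lra.
Qed.

Lemma sum_n_single (u : nat -> R) (m N : nat) :
  (m <= N)%N -> (forall j, j <> m -> u j = 0) -> sum_n u N = u m.
Proof.
move=> le_mN u0; have sum_lt K : (K < m)%N -> sum_n u K = 0.
  elim: K => [|K IHK] ltK; first by rewrite sum_O u0 //; lia.
  by rewrite sum_Sn IHK ?u0 /plus /=; [ring|lia|lia].
elim: N le_mN => [|N IHN] le_mN.
  by rewrite sum_O; congr u; lia.
rewrite sum_Sn /plus /=; case: (eqVneq m N.+1) => [eq_m|ne].
  by rewrite sum_lt ?eq_m //; ring.
by rewrite IHN ?(u0 N.+1) ?Rplus_0_r //; move: ne; lia.
Qed.

Lemma is_derive_cells (b : nat -> R) (g h : R -> R) (t : R) :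
  bump_like g -> (forall t, is_derive g t (h t)) -> bump_like h ->
  is_derive (fun t => b (nat_floor t) * g (t - INR (nat_floor t))) t
    (b (nat_floor t) * h (t - INR (nat_floor t))).
Proof.
move=> Bg dg Bh.
have cells f y (N : nat) : bump_like f -> y < INR N.+1 ->
    sum_n (fun m => b m * f (y - INR m)) N =
    b (nat_floor y) * f (y - INR (nat_floor y)).
  move=> Bf lt_yN; apply: (@sum_n_single (fun m => b m * f (y - INR m))).
    exact: nat_floor_leq.
  by move=> j ne; rewrite bump_like_other_cell // Rmult_0_r.
set N := (nat_floor t).
have lt_tN : t < INR N.+1 by rewrite S_INR; apply: lt_nat_floor_plus1.
rewrite -[X in is_derive _ _ X](cells h t N) //.
apply: (is_derive_ext_loc (fun t => sum_n (fun m => b m * g (t - INR m)) N)).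
  pose d := INR N.+1 - t; have d0 : 0 < d by rewrite /d; lra.
  exists (mkposreal d d0) => y.
  rewrite /ball /= /AbsRing_ball /abs /minus /plus /opp /=.
  by move=> /Rabs_def2 near_y; apply: cells => //; rewrite /d in near_y; lra.
apply: (is_derive_sum_n (fun m t => b m * g (t - INR m))) => m _.
apply: is_derive_scal.
have d1 : is_derive (fun t => t - INR m) t 1 by auto_derive => //; ring.
apply: is_derive_eq
  (is_derive_comp g (fun t => t - INR m) _ _ _ (dg (t - INR m)) d1) _.
by rewrite /scal /= /mult /=; ring.
Qed.

(** * Smoothness of functions glued from cubes *)

(** The factors may differ between coordinates, so that a partial derivative, which changes a single
    factor, has the same form. *)
Definition cell_fun (n : nat) (a : ('I_n -> nat) -> R) (g : 'I_n -> R -> R)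
    (x : 'I_n -> R) : R :=
  a (fun j => nat_floor (x j)) *
  \big[Rmult/1]_j g j (x j - INR (nat_floor (x j))).

Lemma continuous_big_plus (U : UniformSpace) (J : Type) (r : seq J)
    (F : J -> U -> R) (x : U) :
  (forall j, continuous (F j) x) ->
  continuous (fun y => \big[Rplus/0]_(j <- r) F j y) x.
Proof.
move=> contF; elim: r => [|j r IHr].
  apply: (continuous_ext (fun=> 0)) => [y|]; first by rewrite big_nil.
  exact: continuous_const.
apply: (continuous_ext (fun y => F j y + \big[Rplus/0]_(j <- r) F j y)) => [y|].
  by rewrite big_cons.
exact: continuous_plus.
Qed.

Lemma continuous_big_mult (U : UniformSpace) (J : Type) (r : seq J)
    (F : J -> U -> R) (x : U) :
  (forall j, continuous (F j) x) ->
  continuous (fun y => \big[Rmult/1]_(j <- r) F j y) x.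
Proof.
move=> contF; elim: r => [|j r IHr].
  apply: (continuous_ext (fun=> 1)) => [y|]; first by rewrite big_nil.
  exact: continuous_const.
apply: (continuous_ext (fun y => F j y * \big[Rmult/1]_(j <- r) F j y)) => [y|].
  by rewrite big_cons.
exact: continuous_mult.
Qed.

Lemma continuous_cell_fun n (a : ('I_n -> nat) -> R) g (x : 'I_n -> R) :
  (forall i, bump_like (g i)) -> continuous (cell_fun a g) x.
Proof.
(* In the unit ball around [x], [y j < x j + 1 < nat_floor (x j) + 2], so all cells met by the ball
   have indices below [N]. *)
move=> Bg; pose N := (\max_j nat_floor (x j)).+2.
pose S y := \big[Rplus/0]_(c : {ffun 'I_n -> 'I_N})
  (a (fun j => c j) * \big[Rmult/1]_j g j (y j - INR (c j))).
apply: (continuous_ext_loc _ S).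
  exists (mkposreal 1 Rlt_0_1) => y near_y.
  have lt_yN j : (nat_floor (y j) < N)%N.
    have := near_y j; rewrite /ball /= /AbsRing_ball /abs /minus /plus /opp /=.
    move=> /Rabs_def2[lt_y _].
    have lt_x := lt_nat_floor_plus1 (x j).
    have le_x : INR (nat_floor (x j)) <= INR (\max_j nat_floor (x j)).
      by apply: le_INR; apply/leP; apply: (leq_bigmax_cond j).
    by rewrite ltnS; apply: nat_floor_leq; rewrite !S_INR; lra.
  pose c0 : {ffun 'I_n -> 'I_N} := [ffun j => Ordinal (lt_yN j)].
  rewrite /S (bigD1 c0) //= [X in _ + X]big1 ?Rplus_0_r => [|c ne_c].
    rewrite /cell_fun; congr (_ * _).
      by congr a; apply: functional_extensionality => j; rewrite ffunE.
    by apply: eq_bigr => j _; rewrite ffunE.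
  have [j ne_cj] : exists j, c j != c0 j.
    apply/existsP; rewrite -negb_forall; apply: contra ne_c => /forallP eq_c.
    by apply/eqP/ffunP => j; apply/eqP.
  rewrite (bigD1 j) //= bump_like_other_cell //; first ring.
  by move=> eq_c; case/eqP: ne_cj; apply: val_inj; rewrite ffunE.
apply: continuous_big_plus => c.
apply: (continuous_mult (fun=> a (fun j => c j))); first exact: continuous_const.
apply: continuous_big_mult => j.
apply: (continuous_comp (fun y : 'I_n -> R => y j - INR (c j)) (g j)); last first.
  exact: bump_like_continuous.
apply: (continuous_minus (fun y : 'I_n -> R => y j)); last exact: continuous_const.
by move=> P [d ballP]; exists d => y near_y; apply: ballP.
Qed.

Lemma is_partial_cell_fun n (a : ('I_n -> nat) -> R) g (i : 'I_n) h :
  (forall j, bump_like (g j)) -> bump_like h ->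
  (forall t, is_derive (g i) t (h t)) ->
  is_partial_on_orthant (cell_fun a g) i (cell_fun a [eta g with i |-> h]).
Proof.
move=> Bg Bh dg x x0.
have FF : ProperFilter (within (fun t => 0 <= t) (locally (x i))).
  split=> [P|]; last by apply: within_filter; apply: locally_filter.
  by move=> /locally_singleton inP; exists (x i); apply: inP.
(* The two-sided derivative restricts to the trace of the neighbourhoods on the half-line. *)
apply: (filterdiff_locally _ (x i)) => [P|]; first exact: filter_imp.
pose C := \big[Rmult/1]_(j | j != i) g j (x j - INR (nat_floor (x j))).
pose b m := a [eta (fun j => nat_floor (x j)) with i |-> m] * C.
have bE f t :
    cell_fun a [eta g with i |-> f] [eta x with i |-> t] =
    b (nat_floor t) * f (t - INR (nat_floor t)).
  rewrite /cell_fun (bigD1 i) //= eqxx /b.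
  have -> : (fun j => nat_floor (if j == i then t else x j)) =
            [eta (fun j => nat_floor (x j)) with i |-> nat_floor t].
    by apply: functional_extensionality => j /=; case: eqP.
  rewrite [X in _ * (_ * X)](_ : _ = C); first by ring.
  by apply: eq_bigr => j /negPf ne; rewrite ne.
have xE : (fun j => [eta x with i |-> x i] j) = x.
  by apply: functional_extensionality => j /=; case: eqP => // ->.
have gE : (fun j => [eta g with i |-> g i] j) = g.
  by apply: functional_extensionality => j /=; case: eqP => // ->.
rewrite -[X in cell_fun _ _ X]xE bE.
apply: (is_derive_ext (fun t => b (nat_floor t) * g i (t - INR (nat_floor t)))).
  by move=> t; rewrite -[X in cell_fun _ X _]gE bE.
exact: is_derive_cells.
Qed.

Lemma smooth_cell_fun n (a : ('I_n -> nat) -> R) g :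
  (forall i, bump_like (g i)) -> smooth_on_orthant (cell_fun a g).
Proof.
move=> Bg k.
have cont g' : (forall i, bump_like (g' i)) ->
    continuous_on_orthant (cell_fun a g').
  move=> Bg' x _ P locP; have [d near_x] := continuous_cell_fun Bg' locP.
  by exists d => y y_x _; exact: near_x.
elim: k g Bg => [|k IHk] g Bg; first by split; first exact: cont.
split=> [|i]; first exact: cont.
have [h Bh dh] := bump_like_derive (Bg i).
exists (cell_fun a [eta g with i |-> h]); split; first exact: is_partial_cell_fun.
by apply: IHk => j /=; case: eqP.
Qed.

(** * From iterated sums to iterated integrals *)

(** As [phi] is nonnegative with integral 1, the integral up to a point of cell [N] is a convex
    combination of the partial sums without and with the term [b N]. Neighbourhoods of [v], finite
    or infinite, are convex, so the limit carries over. *)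
Lemma is_improper_RInt_cells (b : nat -> R) phi (v : Rbar) :
  bump_like phi -> (forall t, 0 <= phi t) -> is_RInt phi 0 1 1 ->
  is_lim_seq (sum_n b) v ->
  is_improper_RInt
    (fun t => b (nat_floor t) * phi (t - INR (nat_floor t))) v.
Proof.
move=> Bphi phi0 phi1 lim_b.
set h := fun t => _.
have ex_phi c d : ex_RInt phi c d.
  by apply: ex_RInt_continuous => t _; apply: bump_like_continuous.
have cell (N : nat) (beta z : R) : INR N <= beta <= INR N + 1 ->
    is_RInt phi 0 (beta - INR N) z -> is_RInt h (INR N) beta (b N * z).
  move=> Nb int_z.
  have int_z' : is_RInt phi (1 * INR N + - INR N) (1 * beta + - INR N) z.
    have -> : 1 * INR N + - INR N = 0 by ring.
    by have -> : 1 * beta + - INR N = beta - INR N by ring.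
  apply: is_RInt_ext (is_RInt_scal _ _ _ (b N) _
    (is_RInt_comp_lin _ _ _ _ _ _ int_z')).
  move=> t; rewrite Rmin_left ?Rmax_right; try lra.
  move=> t_in; rewrite /h (@nat_floor_eq N); last lra.
  by rewrite /scal /= /mult /= !Rmult_1_l.
(* [S N] adds the first [N] terms, whereas [sum_n b N] adds [N + 1]. *)
pose S N := if N is m.+1 then sum_n b m else 0.
have S_b N : S N + b N = sum_n b N.
  by case: N => [|N]; rewrite ?sum_O ?sum_Sn /S /plus /= ?Rplus_0_l.
have int_N N : is_RInt h 0 (INR N) (S N : R).
  elim: N => [|N IHN]; first exact: is_RInt_point.
  have -> : S N.+1 = plus (S N) (b N * 1) by rewrite /plus /= Rmult_1_r S_b.
  apply: (is_RInt_Chasles _ _ _ _ _ _ IHN); apply: cell; rewrite S_INR; first lra.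
  by have -> : INR N + 1 - INR N = 1 by ring.
have int_h beta : 0 <= beta -> exists2 c, 0 <= c <= 1 &
    is_RInt h 0 beta
      ((1 - c) * S (nat_floor beta) + c * sum_n b (nat_floor beta)).
  move=> beta0; set N := nat_floor beta.
  have leN : INR N <= beta by apply: nat_floor_le.
  have ltN : beta < INR N + 1 by apply: lt_nat_floor_plus1.
  have int_c := RInt_correct _ _ _ (ex_phi 0 (beta - INR N)).
  exists (RInt phi 0 (beta - INR N)).
    split; first by apply: RInt_ge_0 => //; lra.
    rewrite -(is_RInt_unique _ _ _ _ phi1).
    rewrite -(RInt_Chasles phi 0 (beta - INR N) 1) // /plus /=.
    have : 0 <= RInt phi (beta - INR N) 1 by apply: RInt_ge_0 => //; lra.
    by lra.
  move: int_c; set c := RInt _ _ _ => int_c.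
  have -> : (1 - c) * S N + c * sum_n b N = plus (S N) (b N * c).
    by rewrite -S_b /plus /=; ring.
  by apply: (is_RInt_Chasles _ _ _ _ _ _ (int_N N)); apply: cell => //; lra.
split=> [beta /int_h[c _ int_c]|]; first by eexists; exact: int_c.
have convex (P : R -> Prop) :
    (forall x y c, 0 <= c <= 1 -> P x -> P y -> P ((1 - c) * x + c * y)) ->
    eventually (fun N => P (sum_n b N)) ->
    Rbar_locally' p_infty (fun beta => P (RInt h 0 beta)).
  (* Beyond [N0 + 1], both partial sums in the combination have index at least [N0]. *)
  move=> convP [N0 PN]; exists (INR N0.+1) => beta lt_beta.
  have beta0 : 0 <= beta by have := pos_INR N0.+1; lra.
  have [c c01 /is_RInt_unique ->] := int_h beta beta0.
  have : (N0.+1 < (nat_floor beta).+1)%coq_nat.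
    apply: INR_lt; rewrite (S_INR (nat_floor _)).
    by have := lt_nat_floor_plus1 beta; lra.
  case: (nat_floor beta) => [|N] ltN; first lia.
  by apply: convP => //; apply: PN; lia.
apply/is_lim_spec; move/is_lim_seq_spec: lim_b.
have between x y c : 0 <= c <= 1 ->
    x <= (1 - c) * x + c * y <= y \/ y <= (1 - c) * x + c * y <= x.
  by move=> c01; case: (Rle_dec x y) => ?; [left|right]; nra.
case: v => [l| |] lim_b.
- move=> eps; apply: (convex (fun z => Rabs (z - l) < eps)) (lim_b eps).
  move=> x y c c01 /Rabs_def2[? ?] /Rabs_def2[? ?].
  by have ? := between x y c c01; apply: Rabs_def1; lra.
- move=> M; apply: (convex (Rlt M)) (lim_b M) => x y c c01 ? ?.
  by have := between x y c c01; lra.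
- move=> M; apply: (convex (Rgt M)) (lim_b M) => x y c c01 ? ?.
  by have := between x y c c01; lra.
Qed.

Lemma Rbar_mult_1_l (v : Rbar) : Rbar_mult 1 v = v.
Proof.
apply: is_Rbar_mult_unique; case: v => [x| |].
- by rewrite /is_Rbar_mult /= Rmult_1_l.
- exact: is_Rbar_mult_sym (is_Rbar_mult_p_infty_pos 1 Rlt_0_1).
- exact: is_Rbar_mult_sym (is_Rbar_mult_m_infty_pos 1 Rlt_0_1).
Qed.

(** Each variable of [l] is integrated against bumps of mass 1; the bumps in the other variables
    remain as a real factor. *)
Lemma is_iterated_RInt_cell_fun n (a : ('I_n -> nat) -> R) phi l x (v : Rbar) :
  bump_like phi -> (forall t, 0 <= phi t) -> is_RInt phi 0 1 1 -> uniq l ->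
  is_iterated_sum a l (fun j => nat_floor (x j)) v ->
  is_iterated_RInt_seq (cell_fun a (fun=> phi)) l x
    (Rbar_mult
      (\big[Rmult/1]_(j | j \notin l) phi (x j - INR (nat_floor (x j)))) v).
Proof.
move=> Bphi phi0 phi1; elim: l x v => [|i l IHl] x v /=.
  by move=> _ -> /=; congr Rbar.Finite; rewrite /cell_fun Rmult_comm.
move=> /andP[il ul] [h [sum_h lim_h]].
set C := \big[Rmult/1]_(j | _) _.
exists (fun t => C * (h (nat_floor t) * phi (t - INR (nat_floor t)))); split.
  move=> t t0.
  have floorE : (fun j => nat_floor ([eta x with i |-> t] j)) =
      [eta (fun j => nat_floor (x j)) with i |-> nat_floor t].
    by apply: functional_extensionality => j /=; case: eqP.
  have := sum_h (nat_floor t); rewrite -floorE => /(IHl _ _ ul) /=.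
  rewrite (bigD1 i) //= eqxx [X in _ * X * _](_ : _ = C).
    by congr is_iterated_RInt_seq; congr Rbar.Finite; ring.
  apply: eq_big => [j|j /andP[_ /negPf ->] //].
  by rewrite inE negb_or andbC.
have [ex_h lim_RInt] := is_improper_RInt_cells Bphi phi0 phi1 lim_h.
split=> [b b0|]; first by apply: ex_RInt_scal; apply: ex_h.
(* If [C] is 0 and [v] infinite, the integrals are all 0, in accordance with [Rbar_mult], where 0
   times infinity is 0. *)
apply: is_lim_ext_loc (is_lim_scal_l _ C _ _ lim_RInt).
by exists 0 => b b0; rewrite RInt_scal //; apply: ex_h; lra.
Qed.

Theorem corollary3 (n : nat) (hn : (2 <= n)%N) (s : 'S_n -> Rbar) :
  exists f : ('I_n -> R) -> R,
    smooth_on_orthant f /\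
    forall sigma : 'S_n, is_iterated_RInt f sigma (s sigma).
Proof.
pose order (sigma : 'S_n) := rev [seq sigma i | i <- enum 'I_n].
have mem_order sigma i : i \in order sigma.
  by rewrite mem_rev -(permKV sigma i) map_f ?mem_enum.
have uniq_order sigma : uniq (order sigma).
  by rewrite rev_uniq map_inj_uniq ?enum_uniq //; apply: perm_inj.
have inj_order : injective order.
  move=> sigma tau /(can_inj revK) /eq_in_map eq_st.
  by apply/permP => i; apply: eq_st; rewrite mem_enum.
have [a sum_a] := exists_array s inj_order uniq_order mem_order (ltnW hn).
have [phi [Bphi phi0 phi1]] := exists_bump.
exists (cell_fun a (fun=> phi)); split; first exact: smooth_cell_fun.
move=> sigma.
have := is_iterated_RInt_cell_fun Bphi phi0 phi1 (uniq_order sigma)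
  (sum_a sigma (fun j => nat_floor 0)).
(* All variables are integrated, so the product of the remaining bumps is empty. *)
rewrite big_pred0 => [|j]; last by rewrite mem_order.
by rewrite Rbar_mult_1_l.
Qed.
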